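(* Let $G$ be a path of order $n\geq 2$ and let $D=\{v\}$ be a minimum fixing set of $G$. Then $f(v;D)=\lfloor \frac{n}{2}\rfloor=F_{sum}(D)$ and $F\%(D)=\frac{1}{\lfloor \frac{n}{2}\rfloor}$.
   Context: Graphs are finite, simple and undirected, with vertex set $V(G)$; the order of $G$ is $|V(G)|$. $\Gamma(G)$ is the automorphism group of $G$, and for a vertex $x$, $\Gamma_x(G)=\{g\in\Gamma(G): g(x)=x\}$ is its stabilizer. A set $D\subseteq V(G)$ is a fixing set of $G$ if the only automorphism $g$ with $g(x)=x$ for all $x\in D$ is the identity; a minimum fixing set is a fixing set of minimum cardinality. The orbit of $v$ is $\mathcal{O}(v)=\{g(v): g\in\Gamma(G)\}$. $V_s(G)$ denotes the set of unordered pairs $(u,v)$ of vertices with $u\neq v$ and $\mathcal{O}(u)=\mathcal{O}(v)$. A vertex $x$ fixes a pair $(u,v)\in V_s(G)$ if for every $h\in\Gamma_x(G)$ we have $h(u)\neq v$ or $h(v)\neq u$. The fixed neighborhood of $x$ is $F(x)=\{(u,v)\in V_s(G): x \text{ fixes } (u,v)\}$. Let $G$ be connected and $D$ a minimum fixing set of $G$. For $x\in D$ and $(u,v)\in F(x)$, put $\mathcal{F}(u,v)=\{F(y): y\in D \text{ and } (u,v)\in F(y)\}$. The fixing share of $x\in D$ in $D$ is $$f(x;D)=\sum_{(u,v)\in F(x)}\frac{1}{|\mathcal{F}(u,v)|}.$$ The fixing sum and fixing percentage of $G$ with respect to $D$ are $F_{sum}(D)=\sum_{x\in D}f(x;D)$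 and $F\%(D)=\frac{|D|}{F_{sum}(D)}$. *)

(* Defs.v *)
From mathcomp Require Import all_boot all_order all_fingroup all_algebra.

Set Implicit Arguments.
Unset Strict Implicit.
Unset Printing Implicit Defensive.

Import GRing.Theory.
Local Open Scope ring_scope.

Record sgraph := SGraph {
  svertex :> finType;
  sedge : rel svertex;
  sedge_sym : symmetric sedge;
  sedge_irrefl : irreflexive sedge
}.

Definition sg_iso (G H : sgraph) : Prop :=
  exists f : G -> H,
    bijective f /\ forall x y : G, sedge (f x) (f y) = sedge x y.

Section PathGraph.
Variable n : nat.

Definition path_edge : rel 'I_n :=
  fun i j => (i.+1 == j :> nat) || (j.+1 == i :> nat).

Lemma path_edge_sym : symmetric path_edge.
Proof. by move=> i j; rewrite /path_edge orbC. Qed.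

Lemma path_edge_irrefl : irreflexive path_edge.
Proof. by move=> i; rewrite /path_edge orbb gtn_eqF. Qed.

Definition path_graph : sgraph := SGraph path_edge_sym path_edge_irrefl.

End PathGraph.

Definition is_path (G : sgraph) (n : nat) : Prop := sg_iso G (path_graph n).

Section Fixing.
Variable G : sgraph.
Implicit Types (x y u v : G) (D : {set G}).

Definition sg_aut : {set {perm G}} :=
  [set g : {perm G} | [forall x, forall y, sedge (g x) (g y) == sedge x y]].

Lemma sg_autP (g : {perm G}) :
  reflect (forall x y, sedge (g x) (g y) = sedge x y) (g \in sg_aut).
Proof.
rewrite inE; apply: (iffP forallP) => [gP x y|gP x].
  by have /forallP/(_ y)/eqP := gP x.
by apply/forallP=> y; rewrite gP.
Qed.

Lemma sg_aut_group_set : group_set sg_aut.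
Proof.
apply/group_setP; split; first by apply/sg_autP=> x y; rewrite !perm1.
move=> g h /sg_autP gP /sg_autP hP; apply/sg_autP=> x y.
by rewrite !permM hP gP.
Qed.

Canonical sg_aut_group := Group sg_aut_group_set.

Definition fixing_set D : Prop :=
  forall g : {perm G}, g \in sg_aut -> {in D, forall x, g x = x} -> g = 1%g.

Definition min_fixing_set D : Prop :=
  fixing_set D /\ forall D', fixing_set D' -> (#|D| <= #|D'|)%N.

Definition sg_orbit v : {set G} := orbit 'P sg_aut v.

Definition sg_stab x : {set {perm G}} := 'C_sg_aut[x | 'P]%g.

Definition sym_pair u v : bool := (u != v) && (sg_orbit u == sg_orbit v).

(* An unordered pair (u, v) is encoded as the two-element set [set u; v]. *)
Definition sym_pairs : {set {set G}} :=
  [set [set p.1; p.2] | p : G * G & sym_pair p.1 p.2].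

Definition fixes_pair x u v : bool :=
  [forall h in sg_stab x, (h u != v) || (h v != u)].

Definition fixes x (p : {set G}) : bool :=
  [forall u, forall v, (p == [set u; v]) ==> fixes_pair x u v].

Definition fixed_nbhd x : {set {set G}} := [set p in sym_pairs | fixes x p].

Lemma sym_pairC u v : sym_pair u v = sym_pair v u.
Proof. by rewrite /sym_pair eq_sym [_ == sg_orbit v]eq_sym. Qed.

Lemma fixes_pairC x u v : fixes_pair x u v = fixes_pair x v u.
Proof. by apply: eq_forallb => h; rewrite orbC. Qed.

Lemma set2_eq u v a b : [set u; v] = [set a; b] ->
  (u = a /\ v = b) \/ (u = b /\ v = a).
Proof.
move=> E.
have := set21 u v; have := set22 u v; rewrite E !inE.
have := set21 a b; have := set22 a b; rewrite -E !inE.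
by do 4![case/orP=> /eqP ?]; subst; auto.
Qed.

Lemma in_sym_pairs u v : ([set u; v] \in sym_pairs) = sym_pair u v.
Proof.
apply/imsetP/idP => [[[a b]]|uv]; last by exists (u, v); rewrite ?inE.
by rewrite inE /= => ab /set2_eq [[-> ->]|[-> ->]]; rewrite // sym_pairC.
Qed.

(* The condition does not depend on the order in which the pair is listed. *)
Lemma fixes_set2 x u v : fixes x [set u; v] = fixes_pair x u v.
Proof.
apply/forallP/idP => [/(_ u)/forallP/(_ v)|uv a]; first by rewrite eqxx.
apply/forallP=> b; apply/implyP=> /eqP/set2_eq [[<- <-]|[<- <-]] //.
by rewrite fixes_pairC.
Qed.

Lemma in_fixed_nbhd x u v :
  ([set u; v] \in fixed_nbhd x) = sym_pair u v && fixes_pair x u v.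
Proof. by rewrite inE in_sym_pairs fixes_set2. Qed.

(* The distinct sets F(y), not the vertices y, are counted. *)
Definition fixing_nbhds D (p : {set G}) : {set {set {set G}}} :=
  [set fixed_nbhd y | y in D & p \in fixed_nbhd y].

Definition fixing_share x D : rat :=
  \sum_(p in fixed_nbhd x) 1 / #|fixing_nbhds D p|%:R.

Definition fixing_sum D : rat := \sum_(x in D) fixing_share x D.

Definition fixing_percentage D : rat := #|D|%:R / fixing_sum D.

End Fixing.

(* Main.v *)
Require Import Defs.
From mathcomp Require Import all_boot all_order all_fingroup all_algebra.
From mathcomp Require Import zify.

Set Implicit Arguments.
Unset Strict Implicit.
Unset Printing Implicit Defensive.

Import GRing.Theory.
Local Open Scope ring_scope.

(** The argument separates what holds for every graph with a one-vertex fixing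
set from what is special to paths.

If [set v] is a fixing set then the stabilizer of v is trivial, and the
identity never exchanges two distinct vertices, so v fixes every symmetric
pair ([fixed_nbhd_fixing1]). Since F(v) is the only fixed neighborhood that
comes from D = [set v], every weight 1 / |F(u,v)| in the fixing share is 1, and
the share is the number of symmetric pairs ([fixing_share1]).

It remains to count the symmetric pairs of a path. An automorphism of the path
0 - 1 - ... - n-1 sends the endpoint 0 to an endpoint, because an inner vertex
has two neighbors and 0 has at most one; one that fixes 0 fixes every vertex,
by walking along the path. Composing with the reversal when 0 goes to n-1
shows that the only automorphisms are the identity and the reversal
([path_mono_id_or_rev]). The symmetric pairs are therefore the two-element
sets {i, n-1-i}, and exactly one member of each is smaller than n/2
([card_path_sym_pairs]). *)

(** * Graphs with a one-vertex fixing set *)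

Section OneVertexFixingSet.
Variable G : sgraph.
Implicit Types v : G.

Lemma fixed_nbhd_fixing1 v :
  fixing_set [set v] -> fixed_nbhd v = sym_pairs G.
Proof.
move=> fixv; apply/setP=> p; rewrite inE.
have [/imsetP[[a b]]|//] := boolP (p \in sym_pairs G).
rewrite inE /= => /andP[ab _] ->; rewrite fixes_set2 /=.
apply/forall_inP=> h; rewrite inE => /andP[hA /astab1P hv].
suff -> : h = 1%g by rewrite perm1 ab.
apply: fixv => // x /set1P->.
exact: hv.
Qed.

Lemma fixing_share1 v : fixing_share v [set v] = #|fixed_nbhd v|%:R.
Proof.
rewrite -sum1_card natr_sum; apply: eq_bigr => p pF.
suff -> : fixing_nbhds [set v] p = [set fixed_nbhd v] by rewrite cards1 divr1.
apply/setP=> A; rewrite inE; apply/imsetP/eqP=> [[y]|->].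
  by rewrite inE => /andP[/set1P-> _] ->.
by exists v; rewrite // inE set11.
Qed.

Lemma fixing_sum1 v : fixing_sum [set v] = fixing_share v [set v].
Proof. by rewrite /fixing_sum big_set1. Qed.

End OneVertexFixingSet.

(** * Automorphisms of the standard path *)

Lemma path_edge_rev n : {mono @rev_ord n : i j / path_edge i j}.
Proof.
move=> i j; rewrite /path_edge /=.
have := ltn_ord i; have := ltn_ord j; lia.
Qed.

Section PathAutomorphisms.
Variable n : nat.
Implicit Types p : 'I_n.+1 -> 'I_n.+1.

(** Walking away from the fixed endpoint, the image of i+1 is a neighbor of i,
and i-1 is already the image of i-1. *)
Lemma path_mono_fix0 p :
  injective p -> {mono p : i j / path_edge i j} -> p ord0 = ord0 -> p =1 id.
Proof.
move=> injp edgep p0 [k ltkn].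
elim/ltn_ind: k ltkn => -[|k] IH ltkn.
  by rewrite (_ : Ordinal ltkn = ord0) //; apply: val_inj.
have ltk := ltnW ltkn.
have := edgep (Ordinal ltk) (Ordinal ltkn).
rewrite (IH _ (ltnSn k)) {2}/path_edge /= eqxx /= => /orP[] /eqP /= pk.
  by apply: val_inj.
have ltk1 : (k.-1 < n.+1)%N by lia.
have : p (Ordinal ltkn) = p (Ordinal ltk1).
  have ltk1k : (k.-1 < k.+1)%N by lia.
  by rewrite (IH _ ltk1k); apply: val_inj => /=; lia.
by move/injp/(congr1 val) => /=; lia.
Qed.

(** An inner vertex has two distinct neighbors, whose preimages would be two
distinct neighbors of 0. *)
Lemma path_mono_end0 p :
  injective p -> {mono p : i j / path_edge i j} ->
  p ord0 = ord0 \/ p ord0 = ord_max.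
Proof.
move=> injp edgep.
have [q pK qK] := injF_bij injp.
have [p0|p_gt0] := posnP (p ord0); first by left; apply: val_inj.
have [p_lt|p_ge] := ltnP (p ord0) n; last first.
  by right; apply: val_inj => /=; have := ltn_ord (p ord0); lia.
have lt1 : ((p ord0).-1 < n.+1)%N by lia.
have lt2 : ((p ord0).+1 < n.+1)%N by lia.
have nbr0 j : path_edge (p ord0) j -> q j = 1%N :> nat.
  by rewrite -{1}(qK j) edgep /path_edge /= orbF => /eqP.
have q1 : q (Ordinal lt1) = 1%N :> nat.
  by apply: nbr0; rewrite /path_edge /=; lia.
have q2 : q (Ordinal lt2) = 1%N :> nat.
  by apply: nbr0; rewrite /path_edge /=; lia.
have /(can_inj qK)/(congr1 val) /= : q (Ordinal lt1) = q (Ordinal lt2).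
  by apply: val_inj; rewrite /= q1 q2.
lia.
Qed.

Lemma path_mono_id_or_rev p :
  injective p -> {mono p : i j / path_edge i j} ->
  p =1 id \/ p =1 @rev_ord n.+1.
Proof.
move=> injp edgep; have [p0|pmax] := path_mono_end0 injp edgep.
  by left; apply: path_mono_fix0.
right=> i; apply: rev_ord_inj; rewrite rev_ordK.
apply: (path_mono_fix0 (p := @rev_ord n.+1 \o p)).
- exact: inj_comp rev_ord_inj injp.
- by move=> a b; rewrite /= path_edge_rev edgep.
by rewrite /= pmax; apply: val_inj; rewrite /= subnn.
Qed.

End PathAutomorphisms.

(** * Symmetric pairs of a path *)

Section PathSymmetricPairs.
Variables (G : sgraph) (n : nat).
Variables (f : G -> 'I_n.+1) (f' : 'I_n.+1 -> G).
Hypotheses (fK : cancel f f') (f'K : cancel f' f).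
Hypothesis edgef : forall x y, path_edge (f x) (f y) = sedge x y.

Let mirror x := f' (rev_ord (f x)).

Let mirrorK : involutive mirror.
Proof. by move=> x; rewrite /mirror f'K rev_ordK fK. Qed.

Let mirror_aut : perm (inv_inj mirrorK) \in sg_aut G.
Proof.
by apply/sg_autP=> x y; rewrite !permE -!edgef !f'K path_edge_rev.
Qed.

Let aut_mirror h x : h \in sg_aut G -> h x = x \/ h x = mirror x.
Proof.
move/sg_autP=> hA.
have injp : injective (fun i => f (h (f' i))).
  by move=> i j /(can_inj fK)/perm_inj/(can_inj f'K).
have edgep : {mono (fun i => f (h (f' i))) : i j / path_edge i j}.
  by move=> i j; rewrite edgef hA -edgef !f'K.
have [E|E] := path_mono_id_or_rev injp edgep; have {E} := E (f x);
  rewrite fK => E; [left | right].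
  exact: can_inj fK _ _ E.
by rewrite /mirror -E fK.
Qed.

Let sym_pair_mirror u v : sym_pair u v = (u != v) && (v == mirror u).
Proof.
rewrite /sym_pair; case: eqVneq => //= uv.
apply/eqP/eqP => [E|->].
  have : v \in sg_orbit u by rewrite E orbit_refl.
  case/orbitP=> h hA /= huv; move: uv; rewrite -huv /aperm.
  by case: (aut_mirror u hA) => // ->; rewrite eqxx.
apply/esym/orbit_eqP/imsetP.
by exists (perm (inv_inj mirrorK)); rewrite //= /aperm permE.
Qed.

(** The member of {x, mirror x} that lies in the first half of the path
represents the pair; the middle vertex of a path of odd order lies in neither
half and is its own mirror image, so it contributes nothing. *)
Let sym_pairs_first_half :
  sym_pairs G = [set [set x; mirror x] | x in [set x | f x < n.+1./2]%N].
Proof.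
have fm x : f (mirror x) = (n - f x)%N :> nat by rewrite /mirror f'K.
have half k : (k < n.+1./2)%N = (k.*2 < n)%N by lia.
apply/setP=> P; apply/imsetP/imsetP=> [[[a b]]|[x]]; last first.
  rewrite inE half => xlt ->; exists (x, mirror x) => //.
  rewrite inE /= sym_pair_mirror eqxx andbT.
  by apply/eqP=> /(congr1 (fun y => val (f y))) /=; rewrite fm; lia.
rewrite inE /= sym_pair_mirror => /andP[ab /eqP bE] ->.
have fab : f a != f b :> nat by apply: contra ab => /eqP/val_inj/(can_inj fK)->.
have fb : f b = (n - f a)%N :> nat by rewrite bE fm.
have lta := ltn_ord (f a).
have [alt|age] := ltnP (f a) n.+1./2; first by exists a; rewrite ?inE ?bE.
exists b; first by rewrite inE half; lia.
by rewrite setUC bE mirrorK.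
Qed.

Lemma card_sym_pairs_labelled : #|sym_pairs G| = n.+1./2.
Proof.
rewrite sym_pairs_first_half card_in_imset; last first.
  move=> x y; rewrite !inE => xlt ylt /set2_eq[[]//|[xE _]].
  have : f x = (n - f y)%N :> nat by rewrite xE /mirror f'K.
  by have := ltn_ord (f y); lia.
have leh : (n.+1./2 <= n.+1)%N by lia.
have injw : injective (fun i : 'I_n.+1./2 => f' (widen_ord leh i)).
  by move=> i j /(can_inj f'K)/(congr1 val)/= /val_inj.
rewrite -[RHS]card_ord -(card_imset _ injw).
apply: eq_card => x; rewrite inE; apply/idP/imsetP=> [xlt|[i _ ->]].
  exists (Ordinal xlt) => //; apply: (can_inj fK); rewrite f'K.
  exact: val_inj.
by rewrite f'K /=.
Qed.

End PathSymmetricPairs.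

Lemma card_path_sym_pairs (G : sgraph) (n : nat) :
  (0 < n)%N -> is_path G n -> #|sym_pairs G| = n./2.
Proof.
case: n => // n _ [f [[f' fK f'K] edgef]].
exact: card_sym_pairs_labelled fK f'K edgef.
Qed.

Theorem theorem3p8 (G : sgraph) (n : nat) (v : G) (D : {set G})
    (hn : (2 <= n)%N) (hG : is_path G n)
    (hD : min_fixing_set D) (hDv : D = [set v]) :
  [/\ fixing_share v D = n./2%:R,
      n./2%:R = fixing_sum D
    & fixing_percentage D = 1 / n./2%:R].
Proof.
case: hD => fixD _; subst D.
have share : fixing_share v [set v] = n./2%:R.
  by rewrite fixing_share1 (fixed_nbhd_fixing1 fixD)
             (card_path_sym_pairs (ltnW hn) hG).
by split; rewrite ?/fixing_percentage ?fixing_sum1 share ?cards1.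
Qed.
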